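(* Let $\{\tilde x_k\}_{k\ge1}$, $\{u_k\}_{k\ge1}$, $\{\varepsilon_k\}_{k\ge1}$ and $\{x_k\}_{k\ge0}$ be generated by Algorithm 2 (described in the context). Define $z_0=x_0$ and, for all $k\ge1$, $$z_k=x_k,\qquad \tilde z_k=P_V(\tilde x_k)+P_{V^\perp}(u_k),\qquad v_k=P_V(u_k)+P_{V^\perp}(\tilde x_k).$$ Then, for all $k\ge1$, $$v_k\in(T_V)^{\varepsilon_k}(\tilde z_k),\qquad \|v_k+\tilde z_k-z_{k-1}\|^2+2\varepsilon_k\le\sigma^2\|\tilde z_k-z_{k-1}\|^2,\qquad z_k=z_{k-1}-v_k.$$ As a consequence, the sequences $\{z_k\}_{k\ge0}$, $\{\tilde z_k\}_{k\ge1}$, $\{v_k\}_{k\ge1}$, $\{\varepsilon_k\}_{k\ge1}$ are generated by Algorithm 1 (the HPE method described in the context), with $\lambda_k:=1$ for all $k\ge1$, for solving $0\in T_V(z)$.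
   Context: $\mathcal H$ is a real Hilbert space, $T:\mathcal H\rightrightarrows\mathcal H$ is maximal monotone, $V\subseteq\mathcal H$ is a closed subspace, and $P_V,P_{V^\perp}$ are the orthogonal projections onto $V$ and $V^\perp$. For a maximal monotone $S$ and $\varepsilon\ge0$ the $\varepsilon$-enlargement is $S^\varepsilon(x):=\{v\in\mathcal H:\langle v'-v,x'-x\rangle\ge-\varepsilon\ \ \forall (x',v')\text{ with }v'\in S(x')\}$. The partial inverse of $T$ with respect to $V$ is the (maximal monotone) operator $T_V:\mathcal H\rightrightarrows\mathcal H$ defined by: $v\in T_V(z)$ if and only if $P_V(v)+P_{V^\perp}(z)\in T(P_V(z)+P_{V^\perp}(v))$. It is assumed that there exist $x\in V$, $u\in V^\perp$ with $u\in T(x)$ (equivalently $T_V^{-1}(0)\ne\emptyset$). Algorithm 2: given $x_0\in\mathcal H$ and $\sigma\in[0,1[$, for $k=1,2,\dots$ choose any $(\tilde x_k,u_k,\varepsilon_k)\in\mathcal H\times\mathcal H\times\mathbb R_+$ such that $$u_k\in T^{\varepsilon_k}(\tilde x_k),\qquad \|u_k+\tilde x_k-x_{k-1}\|^2+2\varepsilon_k\le\sigma^2\|P_V(\tilde x_k)+P_{V^\perp}(u_k)-x_{k-1}\|^2,$$ and set $x_k=x_{k-1}-[P_V(u_k)+P_{V^\perp}(\tilde x_k)]$. Algorithm 1 (hybrid proximal extragradient method) for $0\in S(z)$, $S$ maximal monotone: given $z_0\in\mathcal H$ and $\sigma\in[0,1[$, for $k=1,2,\dots$ choose any $(\tilde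 z_k,v_k,\varepsilon_k)\in\mathcal H\times\mathcal H\times\mathbb R_+$ and $\lambda_k>0$ with $v_k\in S^{\varepsilon_k}(\tilde z_k)$ and $\|\lambda_kv_k+\tilde z_k-z_{k-1}\|^2+2\lambda_k\varepsilon_k\le\sigma^2\|\tilde z_k-z_{k-1}\|^2$, and set $z_k=z_{k-1}-\lambda_kv_k$. *)

(* Defs.v *)
From HB Require Import structures.
From mathcomp Require Import all_boot all_order all_algebra.
From mathcomp Require Import all_classical all_reals all_analysis.

Set Implicit Arguments.
Unset Strict Implicit.
Unset Printing Implicit Defensive.

Import Order.TTheory GRing.Theory Num.Theory.
Import numFieldNormedType.Exports.

Local Open Scope classical_set_scope.
Local Open Scope ring_scope.

(* A real Hilbert space is a complete normed module [H] with a positive definite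
   symmetric bilinear form [dot] that satisfies [norm_induced dot]. *)
Definition norm_induced (R : realType) (H : completeNormedModType R)
    (dot : {dot H for idfun}) : Prop :=
  forall x : H, `|x| ^+ 2 = dot x x.

Section Hilbert.
Variables (R : realType) (H : completeNormedModType R).
Variable dot : {dot H for idfun}.
Implicit Types (V : set H) (S T : H -> set H).

Definition closed_subspace V : Prop := submod_closed [in V] /\ closed V.

Definition orthocomplement V : set H :=
  [set y | forall x, V x -> dot x y = 0].

(* The set of candidates is a singleton when [V] is a closed subspace of a
   Hilbert space (projection theorem); the default value [0] is then not used. *)
Definition orthoproj V (x : H) : H :=
  xget 0 [set p | V p /\ orthocomplement V (x - p)].

(* A set-valued operator is a function [T : H -> set H]; [T x v] reads
   "v belongs to T(x)". *)
Definition monotone_operator T : Prop :=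
  forall x x' v v', T x v -> T x' v' -> 0 <= dot (v' - v) (x' - x).

Definition maximal_monotone T : Prop :=
  monotone_operator T /\
  forall S, monotone_operator S -> (forall x, T x `<=` S x) -> S = T.

Definition enlargement T (eps : R) (x : H) : set H :=
  [set v | forall x' v', T x' v' -> - eps <= dot (v' - v) (x' - x)].

Definition partial_inverse V T (z : H) : set H :=
  [set v | T (orthoproj V z + orthoproj (orthocomplement V) v)
             (orthoproj V v + orthoproj (orthocomplement V) z)].

(* In the two records below, the sequences [xt], [u], [zt], [v], [lambda] and
   [eps] start at index 1: their value at index 0 is never used. *)

Record inexact_partial_inverse_seq V T (sigma : R)
    (x xt u : nat -> H) (eps : nat -> R) : Prop := {
  ipi_sigma : 0 <= sigma < 1;
  ipi_eps_ge0 : forall k, (1 <= k)%N -> 0 <= eps k;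
  ipi_mem : forall k, (1 <= k)%N -> enlargement T (eps k) (xt k) (u k);
  ipi_error : forall k, (1 <= k)%N ->
    `|u k + xt k - x k.-1| ^+ 2 + 2 * eps k
      <= sigma ^+ 2 *
         `|orthoproj V (xt k) + orthoproj (orthocomplement V) (u k) - x k.-1| ^+ 2;
  ipi_step : forall k, (1 <= k)%N ->
    x k = x k.-1 - (orthoproj V (u k) + orthoproj (orthocomplement V) (xt k)) }.

Record hpe_seq S (sigma : R)
    (z zt v : nat -> H) (lambda eps : nat -> R) : Prop := {
  hpe_maximal_monotone : maximal_monotone S;
  hpe_sigma : 0 <= sigma < 1;
  hpe_lambda_gt0 : forall k, (1 <= k)%N -> 0 < lambda k;
  hpe_eps_ge0 : forall k, (1 <= k)%N -> 0 <= eps k;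
  hpe_mem : forall k, (1 <= k)%N -> enlargement S (eps k) (zt k) (v k);
  hpe_error : forall k, (1 <= k)%N ->
    `|lambda k *: v k + zt k - z k.-1| ^+ 2 + 2 * lambda k * eps k
      <= sigma ^+ 2 * `|zt k - z k.-1| ^+ 2;
  hpe_step : forall k, (1 <= k)%N -> z k = z k.-1 - lambda k *: v k }.

End Hilbert.

(* Main.v *)
Require Import Defs.
From HB Require Import structures.
From mathcomp Require Import all_boot all_order all_algebra.
From mathcomp Require Import all_classical all_reals all_analysis.
From mathcomp Require Import ring lra.

(** For an orthogonal decomposition [H = V + V^perp], consider the exchange map
    [(z, v) |-> (P_V z + P_(V^perp) v, P_V v + P_(V^perp) z)] on [H * H].  It
    is additive, it is its own inverse ([exchangeK]), and it preserves the
    pairing [(z, v) |-> <v, z>] ([dot_exchange]): expanding, the cross terms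
    vanish and [<P_V v, P_V z> + <P_(V^perp) z, P_(V^perp) v> = <v, z>].

    The graph of the partial inverse [T_V] is the preimage of the graph of [T]
    under this map.  Monotonicity, maximality and membership in an enlargement
    are all expressed by the quantities [<v' - v, z' - z>], so the exchange map
    transports each of them between [T] and [T_V].  Since [(zt_k, v_k)] is the
    image of [(xt_k, u_k)], this turns [u_k \in T^eps (xt_k)] into
    [v_k \in (T_V)^eps (zt_k)].  Moreover the exchange map preserves the sum of
    the two components, [v_k + zt_k = u_k + xt_k], so the two error criteria
    are literally the same inequality, and so are the two update rules.

    All this rests on the projection theorem ([orthoproj_spec]): projections
    are selected by a choice operator, so their existence must be established.
    It comes from completeness, the near-minimizers of the distance to [V]
    having arbitrarily small diameter by the parallelogram law. *)

Set Implicit Arguments.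
Unset Strict Implicit.
Unset Printing Implicit Defensive.

Import Order.TTheory GRing.Theory Num.Theory.
Import numFieldNormedType.Exports.

Local Open Scope classical_set_scope.
Local Open Scope ring_scope.

Section HilbertSpace.
Variables (R : realType) (H : completeNormedModType R).
Variable dot : {dot H for idfun}.

(** * Orthogonality *)

Lemma dot_sym (x y : H) : dot x y = dot y x.
Proof. by rewrite (hermC dot x y) expr0 mul1r. Qed.

Lemma dot0_eq0 (x : H) : norm_induced dot -> dot x x = 0 -> x = 0.
Proof.
move=> hdot; rewrite -hdot => /eqP; rewrite sqrf_eq0 normr_eq0.
by move/eqP.
Qed.

Lemma parallelogram (x y : H) : norm_induced dot ->
  `|x + y| ^+ 2 + `|x - y| ^+ 2 = 2 * (`|x| ^+ 2 + `|y| ^+ 2).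
Proof.
move=> hdot; rewrite !hdot !(linearDl dot) !(linearDr dot).
rewrite !(linearNl dot) !(linearNr dot). rewrite /= (dot_sym y x); ring.
Qed.

Definition linear_subspace (V : set H) : Prop :=
  V 0 /\ forall (a : R) x y, V x -> V y -> V (a *: x + y).

Lemma closed_subspace_linear (V : set H) : closed_subspace V -> linear_subspace V.
Proof.
move=> [[]]; rewrite inE => V0 linV _; split=> // a x y Vx Vy.
by apply: set_mem; apply: linV; apply: mem_set.
Qed.

Lemma linear_subspaceD (V : set H) x y :
  linear_subspace V -> V x -> V y -> V (x + y).
Proof. by move=> [_ linV] Vx Vy; rewrite -(scale1r x); apply: linV. Qed.

Lemma linear_subspaceZ (V : set H) a x : linear_subspace V -> V x -> V (a *: x).
Proof. by move=> [V0 linV] Vx; rewrite -(addr0 (a *: x)); apply: linV. Qed.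

Lemma linear_subspaceB (V : set H) x y :
  linear_subspace V -> V x -> V y -> V (x - y).
Proof. by move=> [_ linV] Vx Vy; rewrite addrC -scaleN1r; apply: linV. Qed.

Lemma orthocomplement_linear (V : set H) :
  linear_subspace (orthocomplement dot V).
Proof.
split=> [w _|a x y Vx Vy w Vw]; first by rewrite (linear0r dot).
rewrite (linearDr dot) (linearZr_LR dot) /= (Vx w Vw) (Vy w Vw) addr0.
exact: mulr0.
Qed.

Lemma orthocomplement_cap0 (V : set H) x : norm_induced dot ->
  V x -> orthocomplement dot V x -> x = 0.
Proof. by move=> hdot Vx Vx'; apply: dot0_eq0 => //; apply: Vx'. Qed.

Lemma sub_biorthocomplement (V : set H) x :
  V x -> orthocomplement dot (orthocomplement dot V) x.
Proof. by move=> Vx y Vy; rewrite dot_sym; apply: Vy. Qed.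

(** * The projection theorem *)

Section Projection.
Hypothesis hdot : norm_induced dot.
Variable V : set H.
Hypothesis hV : closed_subspace V.

Let sqdist (x : H) : R := inf [set `|x - w| ^+ 2 | w in V].

Let near_minimizers (x : H) (e : R) : set H :=
  [set w | V w /\ `|x - w| ^+ 2 <= sqdist x + e].

Lemma sqdist_le x w : V w -> sqdist x <= `|x - w| ^+ 2.
Proof.
move=> Vw; apply: ge_inf; last by exists w.
by exists 0 => _ [y _ <-]; apply: sqr_ge0.
Qed.

Lemma near_minimizers_neq0 x e : 0 < e -> near_minimizers x e !=set0.
Proof.
move=> e0; set D := [set `|x - w| ^+ 2 | w in V].
have [|_ [w Vw <-] /ltW ?] := @inf_adherent _ D _ e0.
  split; last by exists 0 => _ [y _ <-]; apply: sqr_ge0.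
  by exists (`|x - 0| ^+ 2); exists 0 => //; have [] := closed_subspace_linear hV.
by exists w.
Qed.

(** Parallelogram law for [x - a] and [x - b]: their half-sum is [x] minus the
    midpoint of [a] and [b], which lies in [V]. *)
Lemma near_minimizers_diam x e a b :
  near_minimizers x e a -> near_minimizers x e b -> `|a - b| ^+ 2 <= 4 * e.
Proof.
move=> [Va xa] [Vb xb]; have linV := closed_subspace_linear hV.
have /(sqdist_le x) mid : V (2^-1 *: (a + b)).
  by apply: linear_subspaceZ => //; apply: linear_subspaceD.
have := parallelogram (x - b) (x - a) hdot.
have -> : x - b - (x - a) = a - b by rewrite opprB addrC addrA subrK.
have -> : x - b + (x - a) = 2 *: (x - 2^-1 *: (a + b)).
  rewrite scalerBr scalerA divff ?pnatr_eq0// scale1r scaler_nat mulr2n.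
  by rewrite opprD addrACA (addrC (- b)).
rewrite normrZ exprMn (ger0_norm (ler0n _ 2)).
move: mid xa xb; lra.
Qed.

Lemma near_minimizers_closed x e : closed (near_minimizers x e).
Proof.
have -> : near_minimizers x e =
    V `&` (fun w : H => `|x - w| ^+ 2) @^-1` [set y | y <= sqdist x + e] by [].
apply: closedI; first by case: hV.
apply: closed_comp; last exact: closed_le.
move=> w _; apply: cvgM; apply: cvg_norm;
  by apply: cvgB; [apply: cvg_cst | apply: cvg_id].
Qed.

(** The near-minimizers generate a Cauchy filter because their diameters tend to
    0; being closed, they all contain its limit. *)
Lemma closest_point x :
  exists p, V p /\ forall w, V w -> `|x - p| ^+ 2 <= `|x - w| ^+ 2.
Proof.
pose F := filter_from [set e : R | 0 < e] (near_minimizers x).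
have FF : ProperFilter F.
  apply: filter_from_proper => [|e]; last exact: near_minimizers_neq0.
  apply: filter_from_filter; first by exists 1 => /=.
  move=> e1 e2 /= e10 e20; exists (Num.min e1 e2) => /=.
    by rewrite lt_min e10.
  move=> w [Vw xw]; split; split=> //; apply: (le_trans xw);
    by rewrite lerD2l ge_min lexx ?orbT.
have /cauchy_cvg/cvg_ex[p Fp] : cauchy F.
  apply: cauchy_exP => e e0.
  (* The diameter of the near-minimizers at level [d] is at most [2 sqrt d]. *)
  have d0 : 0 < (e / 4) ^+ 2 by rewrite exprn_gt0// divr_gt0.
  have [a ha] := near_minimizers_neq0 x d0.
  exists a; exists ((e / 4) ^+ 2) => // b hb; rewrite -ball_normE /=.
  rewrite -(@ltr_pXn2r _ 2)// ?nnegrE ?(ltW e0)//.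
  apply: (le_lt_trans (near_minimizers_diam ha hb)).
  have : 0 < e ^+ 2 by rewrite exprn_gt0.
  rewrite exprMn; lra.
have Mp e : 0 < e -> near_minimizers x e p.
  move=> e0; apply: (@closed_cvg _ _ F _ id) Fp; first exact: near_minimizers_closed.
  by exists e.
exists p; split; first by case: (Mp 1 ltr01).
move=> w Vw; apply: le_trans (sqdist_le x Vw).
by apply/ler_addgt0Pr => e e0; case: (Mp e e0).
Qed.

(** First-order optimality: the quadratic [t |-> |x - p - t w|^2] is minimal at
    [t = 0], so its linear coefficient vanishes. *)
Lemma closest_point_orthogonal x p : V p ->
  (forall w, V w -> `|x - p| ^+ 2 <= `|x - w| ^+ 2) ->
  orthocomplement dot V (x - p).
Proof.
move=> Vp minp w Vw; have linV := closed_subspace_linear hV.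
set c := dot w (x - p); set N := dot w w.
have N0 : 0 <= N by rewrite /N -hdot sqr_ge0.
have key t : 0 <= t ^+ 2 * N - 2 * t * c.
  have /minp : V (p + t *: w) by apply: linear_subspaceD => //; apply: linear_subspaceZ.
  rewrite opprD addrA !hdot; set r := x - p.
  rewrite (linearBl dot _ r) !(linearBr dot _ r).
  rewrite !(linearZl_LR dot) !(linearZr_LR dot) /= (dot_sym r w) -/c -/N; lra.
(* A value of [t] that makes the bound negative unless [c = 0]. *)
have := key (c / (N + 1)).
have N1 : 0 < N + 1 by lra.
have -> : (c / (N + 1)) ^+ 2 * N - 2 * (c / (N + 1)) * c =
    - (c ^+ 2 * ((N + 2) / (N + 1) ^+ 2)) by field; lra.
rewrite oppr_ge0 pmulr_lle0 ?divr_gt0 ?exprn_gt0//; last by lra.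
by rewrite real_exprn_even_le0 ?num_real//= => /eqP.
Qed.

(** * The orthogonal projections on a closed subspace and on its complement *)

Local Notation P := (orthoproj dot V).
Local Notation Q := (orthoproj dot (orthocomplement dot V)).

Lemma orthoproj_eq (W : set H) x p : linear_subspace W ->
  W p -> orthocomplement dot W (x - p) -> orthoproj dot W x = p.
Proof.
move=> linW Wp Wp'; apply: xget_unique => // q [Wq Wq'].
apply/eqP; rewrite -subr_eq0; apply/eqP.
apply: (orthocomplement_cap0 hdot (V := W)); first exact: linear_subspaceB.
have -> : q - p = (x - p) - (x - q) by rewrite opprB [RHS]addrC addrA subrK.
exact: (linear_subspaceB (orthocomplement_linear W)).
Qed.

Lemma orthoproj_spec x : V (P x) /\ orthocomplement dot V (x - P x).
Proof.
have [p [Vp minp]] := closest_point x.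
have Vp' := closest_point_orthogonal Vp minp.
by rewrite (orthoproj_eq (closed_subspace_linear hV) Vp Vp').
Qed.

Lemma orthoproj_compl x : Q x = x - P x.
Proof.
have [Vp Vp'] := orthoproj_spec x.
apply: orthoproj_eq => //; first exact: orthocomplement_linear.
by rewrite subKr; apply: sub_biorthocomplement.
Qed.

Lemma orthoproj_in x : V (P x).
Proof. by have [] := orthoproj_spec x. Qed.

Lemma orthoproj_compl_in x : orthocomplement dot V (Q x).
Proof. by rewrite orthoproj_compl; have [] := orthoproj_spec x. Qed.

Lemma orthoproj_sum x : P x + Q x = x.
Proof. by rewrite orthoproj_compl addrC subrK. Qed.

Lemma orthoprojB x y : P (x - y) = P x - P y.
Proof.
have linV := closed_subspace_linear hV.
apply: orthoproj_eq => //; first by apply: (linear_subspaceB linV); apply: orthoproj_in.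
have -> : x - y - (P x - P y) = Q x - Q y.
  by rewrite !orthoproj_compl !opprB addrACA [RHS]addrACA (addrC (- y)).
apply: (linear_subspaceB (orthocomplement_linear V)); exact: orthoproj_compl_in.
Qed.

Lemma orthoproj_complB x y : Q (x - y) = Q x - Q y.
Proof.
rewrite !orthoproj_compl orthoprojB.
by rewrite !opprB addrACA [RHS]addrACA (addrC (- y)).
Qed.

Lemma dot_orthoproj x y : dot (P x) (Q y) = 0.
Proof. exact: orthoproj_compl_in (orthoproj_in x). Qed.

(** * The exchange map and the partial inverse *)

Local Notation exchange z v := (P z + Q v).

Lemma orthoproj_exchange z v : P (exchange z v) = P z.
Proof.
apply: orthoproj_eq; [exact: closed_subspace_linear | exact: orthoproj_in |].
by rewrite addrC addKr; apply: orthoproj_compl_in.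
Qed.

Lemma orthoproj_compl_exchange z v : Q (exchange z v) = Q v.
Proof. by rewrite orthoproj_compl orthoproj_exchange addrC addKr. Qed.

Lemma exchangeK z v : exchange (exchange z v) (exchange v z) = z.
Proof. by rewrite orthoproj_exchange orthoproj_compl_exchange orthoproj_sum. Qed.

Lemma exchangeB z v z' v' :
  exchange z' v' - exchange z v = exchange (z' - z) (v' - v).
Proof. by rewrite orthoprojB orthoproj_complB opprD addrACA. Qed.

Lemma exchange_sum z v : exchange z v + exchange v z = z + v.
Proof. by rewrite addrACA (addrC (Q v)) addrACA !orthoproj_sum. Qed.

Lemma dot_exchange z v : dot (exchange v z) (exchange z v) = dot v z.
Proof.
rewrite -[in RHS](orthoproj_sum v) -[in RHS](orthoproj_sum z).
rewrite !(linearDl dot) !(linearDr dot) /= !dot_orthoproj.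
by rewrite ![dot (Q _) (P _)]dot_sym !dot_orthoproj (dot_sym (Q z)).
Qed.

Lemma partial_inverseK (T : H -> set H) :
  partial_inverse dot V (partial_inverse dot V T) = T.
Proof.
by apply/funext => z; apply/funext => v; rewrite /partial_inverse /= !exchangeK.
Qed.

Lemma partial_inverse_monotone (T : H -> set H) :
  monotone_operator dot T -> monotone_operator dot (partial_inverse dot V T).
Proof.
move=> mT x x' v v' /mT h /h; rewrite !exchangeB dot_exchange; exact.
Qed.

(** The partial inverse is an inclusion-preserving involution on operators
    that preserves monotonicity, hence it permutes the maximal elements. *)
Lemma partial_inverse_maximal_monotone (T : H -> set H) :
  maximal_monotone dot T -> maximal_monotone dot (partial_inverse dot V T).
Proof.
move=> [mT maxT]; split; first exact: partial_inverse_monotone.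
move=> S mS TS; rewrite -(partial_inverseK S); congr (partial_inverse _ _ _).
apply: maxT; first exact: partial_inverse_monotone.
move=> x v Tv; apply: TS; rewrite /partial_inverse /=.
by rewrite !exchangeK.
Qed.

Lemma partial_inverse_enlargement (T : H -> set H) (eps : R) (z : H) :
  partial_inverse dot V (enlargement dot T eps) z `<=`
  enlargement dot (partial_inverse dot V T) eps z.
Proof. by move=> v Tzv z' v' /Tzv; rewrite !exchangeB dot_exchange. Qed.

End Projection.
End HilbertSpace.

(** * The algorithm as a hybrid proximal extragradient method *)

Theorem proposition3p5 (R : realType) (H : completeNormedModType R)
    (dot : {dot H for idfun}) (hdot : norm_induced dot)
    (T : H -> set H) (hT : maximal_monotone dot T)
    (V : set H) (hV : closed_subspace V)
    (hsol : exists x u, [/\ V x, orthocomplement dot V u & T x u])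
    (sigma : R) (x xt u : nat -> H) (eps : nat -> R)
    (halg : inexact_partial_inverse_seq dot V T sigma x xt u eps)
    (z zt v : nat -> H)
    (hz0 : z 0%N = x 0%N)
    (hz : forall k, (1 <= k)%N -> z k = x k)
    (hzt : forall k, (1 <= k)%N ->
       zt k = orthoproj dot V (xt k) + orthoproj dot (orthocomplement dot V) (u k))
    (hv : forall k, (1 <= k)%N ->
       v k = orthoproj dot V (u k) + orthoproj dot (orthocomplement dot V) (xt k)) :
  (forall k, (1 <= k)%N ->
     [/\ enlargement dot (partial_inverse dot V T) (eps k) (zt k) (v k),
         `|v k + zt k - z k.-1| ^+ 2 + 2 * eps k
           <= sigma ^+ 2 * `|zt k - z k.-1| ^+ 2
       & z k = z k.-1 - v k]) /\
  hpe_seq dot (partial_inverse dot V T) sigma z zt v (fun=> 1) eps.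
Proof.
case: halg => sigma01 eps0 memT err step.
have zpred k : (1 <= k)%N -> z k.-1 = x k.-1.
  by case: k => // -[|k] _ //=; apply: hz.
have main k : (1 <= k)%N ->
    [/\ enlargement dot (partial_inverse dot V T) (eps k) (zt k) (v k),
        `|v k + zt k - z k.-1| ^+ 2 + 2 * eps k
          <= sigma ^+ 2 * `|zt k - z k.-1| ^+ 2
      & z k = z k.-1 - v k].
  move=> k1; rewrite (zpred k k1) (hz k k1) (hzt k k1) (hv k k1); split.
  - apply: partial_inverse_enlargement => //.
    by rewrite /partial_inverse /= !exchangeK//; apply: memT.
  - by rewrite exchange_sum//; apply: err.
  - exact: step.
split=> //; split=> // [|k k1|k k1|k k1].
- exact: partial_inverse_maximal_monotone.
- by have [] := main k k1.
- by rewrite scale1r mulr1; have [] := main k k1.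
- by rewrite scale1r; have [] := main k k1.
Qed.
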